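(* Let $T$ be a p-string of length $n$ over $\Sigma \cup \Pi$ whose last symbol is a sentinel $\$ \in \Sigma$ occurring nowhere else in $T$. Then the size of the PLST $\mathsf{PLST}(T)$ is $O(n)$; that is, the number of nodes and edges of $\mathsf{PLST}(T)$, together with all information stored at its nodes and edges (depths, suffix links, re-encoding signs, edge labels) and the stored string $T'$, is $O(n)$.
   Context: $\Sigma$ (constant symbols) and $\Pi$ (parameter symbols) are disjoint alphabets of constant size; a p-string is a string over $\Sigma\cup\Pi$. For a string $w$: $|w|$ is its length, $w[i]$ its $i$-th symbol ($1$-indexed), $w[i:j]$ the substring from position $i$ to $j$ ($=\varepsilon$ if $i>j$), $w[:i]=w[1:i]$, $w[i:]=w[i:|w|]$. For strings $u$ and $uv$, write $\mathrm{str}(u,uv)=v$. Let $\mathbb{N}$ denote the non-negative integers. Prev-encoding: for a p-string $w$, $\mathrm{pre}(w)$ is the string over $\Sigma\cup\mathbb{N}$ of length $|w|$ with $\mathrm{pre}(w)[i]=w[i]$ if $w[i]\in\Sigma$; $=0$ if $w[i]\in\Pi$ and $w[i]\ne w[j]$ for all $j<i$; $=i-k$ where $k=\max\{j<i: w[j]=w[i]\}$ otherwise. Strings over $\Sigma\cup\mathbb{N}$ are pv-strings. For a pv-string $u$ and integer $k\ge1$, the $k$-re-encoding $\langle u\rangle_k$ has length $|u|$ with $\langle u\rangle_k[i]=0$ if $u[i]\in\mathbb{N}$ and $u[i]\ge i-k+1$, and $\langle u\rangle_k[i]=u[i]$ otherwise; $\langle u\rangle=\langle u\rangle_1$. For a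 nonempty pv-string $u$, $\mathsf{sl}(u)=\langle u[2:]\rangle$. $\mathsf{PrevSub}(T)=\{\mathrm{pre}(w): w \text{ a substring of } T\}$ (including $\varepsilon$); the parameterized suffix trie $\mathsf{PSTrie}(T)$ is the trie with node set $\mathsf{PrevSub}(T)$, root $\varepsilon$, and an edge from $u$ to $ua$ labeled $a$ whenever $ua\in\mathsf{PrevSub}(T)$. A node is branching if it has at least two children. PLST: a node $u\in\mathsf{PrevSub}(T)$ is Type 1 if it is a leaf or a branching node of $\mathsf{PSTrie}(T)$ (the root is included); it is Type 2 if it is not Type 1 and $\mathsf{sl}(u)$ is Type 1. The node set of $\mathsf{PLST}(T)$ is $V=V_1\cup V_2$ (Type 1 and Type 2 nodes). There is an edge $(u,uv)$ for $u,uv\in V$ iff $v\neq\varepsilon$ and no proper nonempty prefix $v'$ of $v$ has $uv'\in V$. A node $u\in V$ is good if $u\ne\varepsilon$ and $\mathsf{sl}(u)\in V$, and bad otherwise (the root is bad). For a non-root $v\in V$ with parent $u$, the re-encoding sign is $\mathsf{Re}(v)=i-|u|$ if there is $i$ with $|u|<i\le|v|$ and $v[i]=i-1$ (there is at most one such $i$), and $\mathsf{Re}(v)=0$ otherwise. Each node $u$ stores $|u|$, $\mathsf{Re}(u)$, and a pointer $\mathsf{SL}(u)$ to the node $\mathsf{sl}(u)$ if $u$ is good (null otherwise). Each edge $(u,v)$ stores a 1-bit flag telling whether $|v|-|u|=1$; if $|v|-|u|=1$ or both $u,v$ are good it is labeled only by $\mathrm{str}(u,v)[1]$, and otherwise by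 an integer triple $(i,j,k)$ with $\mathrm{str}(u,v)=\langle T'\rangle_k[i:j]$, where $T'$ is a stored subsequence of $\mathrm{pre}(T)$ obtained by removing the parts not referenced by such triples. *)

(* Defs.v *)
From mathcomp Require Import all_boot all_order all_algebra.

Set Implicit Arguments.
Unset Strict Implicit.
Unset Printing Implicit Defensive.

Import Order.TTheory GRing.Theory Num.Theory.

(* The disjoint union of the alphabets is a sum type. In a p-symbol, [inl] is a
   constant and [inr] a parameter; in a pv-symbol, [inl] is a constant and [inr]
   a non-negative integer. *)
Notation pstring Sigma Pi := (seq (Sigma + Pi)%type).
Notation pvstring Sigma := (seq (Sigma + nat)%type).

(* w[i:j], with 1-indexed inclusive bounds i >= 1; empty when j < i. *)
Definition sub (A : Type) (i j : nat) (w : seq A) : seq A :=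
  drop i.-1 (take j w).

(* str(u, v) for u a prefix of v. *)
Definition str (A : Type) (u v : seq A) : seq A := drop (size u) v.

Definition sentinel_terminated (Sigma Pi : finType)
    (d : Sigma) (T : pstring Sigma Pi) : Prop :=
  exists2 T0 : pstring Sigma Pi, T = rcons T0 (inl d) & inl d \notin T0.

(* [seen] is the part of the string already read, most recent symbol first, so
   that (index x seen).+1 is the distance back to the last occurrence of x. *)
Fixpoint pre_rec (Sigma Pi : finType)
    (seen w : pstring Sigma Pi) : pvstring Sigma :=
  match w with
  | [::] => [::]
  | inl a :: w' => inl a :: pre_rec (inl a :: seen) w'
  | inr x :: w' =>
      inr (if inr x \in seen then (index (inr x) seen).+1 else 0)
        :: pre_rec (inr x :: seen) w'
  end.

Definition pre (Sigma Pi : finType) (w : pstring Sigma Pi) : pvstring Sigma :=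
  pre_rec [::] w.

Section PVStrings.

Variable Sigma : finType.
Implicit Types u v : pvstring Sigma.

Definition reenc_sym (k : int) (i : nat) (x : Sigma + nat) : Sigma + nat :=
  match x with
  | inl a => inl a
  | inr m => inr (if (i%:Z - k + 1 <= m%:Z)%R then 0 else m)
  end.

(* The formula for the k-re-encoding is used for every integer k. Deleting
   symbols from pre(T) shifts positions to the left, and the value of k
   which then describes an edge label may be non-positive. *)
Definition reenc (k : int) u : pvstring Sigma :=
  [seq reenc_sym k p.1 p.2 | p <- zip (iota 1 (size u)) u].

(* The junk value at the empty string is [::]. *)
Definition sl u : pvstring Sigma := reenc 1 (behead u).

End PVStrings.

Section PLST.

Variables (Sigma Pi : finType) (T : pstring Sigma Pi).
Implicit Types u v : pvstring Sigma.

Definition PrevSub : seq (pvstring Sigma) :=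
  undup [seq pre (sub i j T) | i <- iota 1 (size T).+1,
                               j <- iota 0 (size T).+1].

(* The children of u in the parameterized suffix trie of T. *)
Definition children u : seq (pvstring Sigma) :=
  [seq v <- PrevSub | (size v == (size u).+1) && prefix u v].

Definition is_leaf u : bool := size (children u) == 0.
Definition is_branching u : bool := 2 <= size (children u).

(* The root is of Type 1 even when T has length 1, in which case it has exactly
   one child. *)
Definition type1 u : bool :=
  (u \in PrevSub) && [|| u == [::], is_leaf u | is_branching u].

Definition type2 u : bool :=
  [&& u \in PrevSub, ~~ type1 u & type1 (sl u)].

Definition plst_nodes : seq (pvstring Sigma) :=
  [seq u <- PrevSub | type1 u || type2 u].

Definition plst_edge u v : bool :=
  [&& u \in plst_nodes, v \in plst_nodes, prefix u v, size u < size v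
    & all (fun l => take l v \notin plst_nodes)
          (iota (size u).+1 (size v - (size u).+1))].

Definition good u : bool := (u != [::]) && (sl u \in plst_nodes).

(* The node u such that (u, v) is an edge; [::] when v is the root. *)
Definition parent v : pvstring Sigma :=
  head [::] [seq u <- plst_nodes | plst_edge u v].

(* The re-encoding sign. The iota ranges over the 1-indexed positions i of v
   with |parent v| < i <= |v|; the value at the root is 0. *)
Definition Re v : nat :=
  let u := parent v in
  head 0 [seq i - size u | i <- iota (size u).+1 (size v - size u)
                         & nth (inr 0) v i.-1 == inr i.-1].

(* The edges labelled by a single symbol, the others being labelled by a triple
   of integers. *)
Definition short_label u v : bool :=
  (size v - size u == 1) || (good u && good v).

End PLST.

(* The stored data structure. A pointer to a node is its index in [st_nodes]. *)

Record node_record := NodeRec {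
  nr_depth : nat;
  nr_re : nat;
  nr_sl : option nat  (* None is the null pointer *)
}.

Inductive edge_label (Sigma : finType) :=
  | LSym of (Sigma + nat)
  | LTriple of nat & nat & int.

Record edge_record (Sigma : finType) := EdgeRec {
  er_src : nat;
  er_dst : nat;
  er_flag : bool;
  er_label : edge_label Sigma
}.

Record plst_store (Sigma : finType) := PlstStore {
  st_nodes : seq node_record;
  st_edges : seq (edge_record Sigma);
  st_text : pvstring Sigma  (* the string T' *)
}.

Definition node_data (Sigma Pi : finType) (T : pstring Sigma Pi)
    (V : seq (pvstring Sigma)) (u : pvstring Sigma) : node_record :=
  NodeRec (size u) (Re T u)
          (if good T u then Some (index (sl u) V) else None).

Definition edge_data (Sigma : finType) (V : seq (pvstring Sigma))
    (lab : pvstring Sigma -> pvstring Sigma -> edge_label Sigma)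
    (e : pvstring Sigma * pvstring Sigma) : edge_record Sigma :=
  EdgeRec (index e.1 V) (index e.2 V) (size e.2 - size e.1 == 1)
          (lab e.1 e.2).

Definition label_ok (Sigma Pi : finType) (T : pstring Sigma Pi)
    (T' : pvstring Sigma) (u v : pvstring Sigma) (l : edge_label Sigma) :
    bool :=
  match l with
  | LSym a => short_label T u v && (ohead (str u v) == Some a)
  | LTriple i j k =>
      [&& ~~ short_label T u v, 1 <= i <= j, j <= size T'
        & str u v == sub i j (reenc k T')]
  end.

(* S stores PLST(T). The order V of the nodes, the order E of the edges, the
   triples and T' may be chosen freely, provided that T' is a subsequence of
   pre(T) each of whose positions is referenced by some triple. *)
Definition stores_plst (Sigma Pi : finType) (T : pstring Sigma Pi)
    (S : plst_store Sigma) : Prop :=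
  exists (V : seq (pvstring Sigma))
         (E : seq (pvstring Sigma * pvstring Sigma))
         (lab : pvstring Sigma -> pvstring Sigma -> edge_label Sigma),
    [/\ uniq V /\ V =i plst_nodes T,
        uniq E /\ (forall u v, ((u, v) \in E) = plst_edge T u v),
        st_nodes S = [seq node_data T V u | u <- V]
          /\ st_edges S = [seq edge_data V lab e | e <- E],
        (forall u v, (u, v) \in E -> label_ok T (st_text S) u v (lab u v))
      & subseq (st_text S) (pre T)
          /\ (forall p, 1 <= p <= size (st_text S) ->
                exists u v i j k,
                  [/\ (u, v) \in E, lab u v = LTriple Sigma i j k
                    & i <= p <= j])].

(* Sizes are counted in machine words: an integer, a symbol, a pointer or a flag
   takes one word. *)

Definition label_size (Sigma : finType) (l : edge_label Sigma) : nat :=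
  match l with LSym _ => 1 | LTriple _ _ _ => 3 end.

(* depth, re-encoding sign and suffix link *)
Definition node_record_size (r : node_record) : nat := 3.

(* the two endpoints, the flag and the label *)
Definition edge_record_size (Sigma : finType) (r : edge_record Sigma) : nat :=
  3 + label_size (er_label r).

Definition plst_size (Sigma : finType) (S : plst_store Sigma) : nat :=
  \sum_(r <- st_nodes S) node_record_size r
  + \sum_(r <- st_edges S) edge_record_size r
  + size (st_text S).

(* Main.v *)
(* Every leaf of the trie is the encoding of a suffix of T, so there are at most
   n + 1 leaves; counting edges by source and by target then gives no more
   branching nodes than leaves, and O(n) nodes of Type 1.  A node pre(c w) is
   determined by sl(pre(c w)) = pre(w), by c when c is a constant, and otherwise
   by which 0 of pre(w), if any, becomes a reference to the deleted first symbol.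
   Since pre(w) contains at most |Pi| zeros, sl has fibres of size at most
   |Sigma| + |Pi| + 1, which bounds the number of nodes of Type 2.  Each node is
   the target of at most one edge, and T' is a subsequence of pre(T).

   For existence, start with T' = pre(T) and delete unreferenced positions one at
   a time: within a referenced interval [i:j] the k-re-encoding depends on i and k
   only through k - i, so shifting i, j and k together preserves the label. *)
Require Import Defs.
From mathcomp Require Import all_boot all_order all_algebra.
From mathcomp Require Import zify.

Set Implicit Arguments.
Unset Strict Implicit.
Unset Printing Implicit Defensive.

(** * Prev-encodings, re-encodings and the fibres of [sl] *)

Section Encoding.

Variables Sigma Pi : finType.
Implicit Types (w s : pstring Sigma Pi) (u v : pvstring Sigma).

Lemma size_pre_rec s w : size (pre_rec s w) = size w.
Proof. by elim: w s => [|[a|a] w IH] s //=; rewrite IH. Qed.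

Lemma size_pre w : size (pre w) = size w.
Proof. exact: size_pre_rec. Qed.

Lemma pre_rec_cat s w1 w2 :
  pre_rec s (w1 ++ w2) = pre_rec s w1 ++ pre_rec (rev w1 ++ s) w2.
Proof.
by elim: w1 s => [|[a|a] w1 IH] s //=; rewrite IH rev_cons -cats1 -catA.
Qed.

Lemma pre_cat w1 w2 : pre (w1 ++ w2) = pre w1 ++ pre_rec (rev w1) w2.
Proof. by rewrite /pre pre_rec_cat cats0. Qed.

Definition back_ref s (c : Sigma + Pi) : Sigma + nat :=
  match c with
  | inl a => inl a
  | inr x => inr (if inr x \in s then (index (inr x) s).+1 else 0)
  end.

Lemma nth_pre_rec s w t c0 d0 : t < size w ->
  nth d0 (pre_rec s w) t = back_ref (rev (take t w) ++ s) (nth c0 w t).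
Proof.
elim: w s t => [|c w IH] s [|t] //=; first by case: c.
by rewrite ltnS => lt_tw; case: c => c; rewrite /= IH // rev_cons -cats1 -catA.
Qed.

Lemma size_reenc k u : size (reenc k u) = size u.
Proof. by rewrite size_map size_zip size_iota minnn. Qed.

Lemma nth_reenc k u t d0 : t < size u ->
  nth d0 (reenc k u) t = reenc_sym k t.+1 (nth d0 u t).
Proof.
move=> lt_tu; rewrite (nth_map (0, d0)) ?size_zip ?size_iota ?minnn //.
by rewrite nth_zip ?size_iota //= nth_iota.
Qed.

(** At 0-indexed position [t], a reference that stays inside [w] has distance at most [t] and
    survives, while one that reaches into [s] has distance at least [t.+1] and is reset to 0. *)
Lemma reenc_pre_rec s w : reenc 1 (pre_rec s w) = pre w.
Proof.
case: w => [|c0 w0] //; set w := c0 :: w0.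
apply: (@eq_from_nth _ (inr 0)); rewrite size_reenc size_pre_rec ?size_pre //.
move=> t lt_tw; rewrite nth_reenc ?size_pre_rec // /pre.
rewrite !(nth_pre_rec _ c0) //; case: (nth c0 w t) => //= x.
rewrite cats0 mem_cat index_cat; congr inr.
case xP: (inr x \in rev _) => /=.
  move: xP; rewrite -index_mem size_rev size_take lt_tw => xP.
  by case: ifP => //; lia.
rewrite size_rev size_take lt_tw.
by case: (inr x \in s) => //=; case: ifP => //; lia.
Qed.

Lemma take_reenc p k u : take p (reenc k u) = reenc k (take p u).
Proof.
case: (ltnP p (size u)) => [lt_pu|le_up]; last by rewrite !take_oversize ?size_reenc.
apply: (@eq_from_nth _ (inr 0)); first by rewrite !(size_take, size_reenc).
move=> t; rewrite size_take size_reenc lt_pu => lt_tp.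
by rewrite nth_take // !nth_reenc ?nth_take // ?size_take ?lt_pu //; lia.
Qed.

(** Whether a symbol is reset depends on its position [i] only through [i - k], so dropping [p]
    symbols is absorbed by [k], which may become non-positive. *)
Lemma drop_reenc p k u : drop p (reenc k u) = reenc (k - p%:Z)%R (drop p u).
Proof.
apply: (@eq_from_nth _ (inr 0)); first by rewrite !(size_drop, size_reenc).
move=> t; rewrite size_drop size_reenc => lt_tp.
rewrite nth_drop !nth_reenc ?nth_drop ?size_drop //; last by lia.
case: (nth _ _ _) => //= m; congr inr.
by congr (if _ then _ else _); lia.
Qed.

Lemma sub_reenc i j k u :
  sub i j (reenc k u) = reenc (k - i.-1%:Z)%R (sub i j u).
Proof. by rewrite /sub take_reenc drop_reenc. Qed.

Lemma pre_zeroP w t x : t < size w -> nth (inr x) w t = inr x ->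
  (nth (inr 0) (pre w) t == inr 0) = (t == index (inr x) w).
Proof.
move=> lt_tw wt; rewrite /pre (nth_pre_rec _ (inr x)) // wt /= cats0 mem_rev.
have wE : w = take t w ++ inr x :: drop t.+1 w.
  by rewrite -[X in X :: _]wt -drop_nth // cat_take_drop.
rewrite {3}wE index_cat; case: ifP => [x_t|_] /=.
  by move: x_t; rewrite -index_mem size_take lt_tw => x_t; apply/eqP/eqP; [|lia].
by rewrite !eqxx addn0 size_take lt_tw eqxx.
Qed.

Definition zeros u : seq nat :=
  [seq t <- iota 0 (size u) | nth (inr 0) u t == inr 0].

(** Each zero sits at the first occurrence of some parameter, so the zeros lie in the image of [Pi]
    under [index]. *)
Lemma size_zeros_pre w : size (zeros (pre w)) <= #|Pi|.
Proof.
have -> : #|Pi| = size [seq index (inr x) w | x <- enum Pi].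
  by rewrite size_map cardE.
apply: uniq_leq_size => [|t]; first by rewrite filter_uniq ?iota_uniq.
rewrite mem_filter mem_iota size_pre => /andP[ut lt_tw].
case: w ut lt_tw => // c w ut lt_tw.
case wt: (nth c (c :: w) t) => [a|x].
  by move: ut; rewrite /pre (nth_pre_rec _ c) // wt.
apply/mapP; exists x; first by rewrite mem_enum.
apply/eqP; rewrite -pre_zeroP //.
by rewrite -wt; apply: set_nth_default.
Qed.

(** Three cases for the deleted first symbol: a constant, a parameter that does not recur, and a
    parameter that recurs first at the zero [t], which then becomes a reference of length [t.+1]. *)
Definition sl_preimages v : seq (pvstring Sigma) :=
  [seq inl a :: v | a <- enum Sigma]
    ++ (inr 0 :: v)
    :: [seq inr 0 :: set_nth (inr 0) v t (inr t.+1) | t <- zeros v].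

Lemma size_sl_preimages w :
  size (sl_preimages (pre w)) <= #|Sigma| + #|Pi| + 1.
Proof.
rewrite size_cat size_map -cardE /= size_map.
by rewrite addnS addn1 ltnS leq_add2l size_zeros_pre.
Qed.

Lemma sl_pre_cons c w : sl (pre (c :: w)) = pre w.
Proof. by rewrite /sl; case: c => c /=; rewrite reenc_pre_rec. Qed.

Lemma mem_sl_preimages c w : pre (c :: w) \in sl_preimages (pre w).
Proof.
have nthE t : t < size w -> nth (inr 0) (pre_rec [:: c] w) t =
    back_ref (rev (take t w) ++ [:: c]) (nth c w t).
  exact: nth_pre_rec.
have nthE0 t : t < size w ->
    nth (inr 0) (pre w) t = back_ref (rev (take t w)) (nth c w t).
  by move=> lt_tw; rewrite /pre (nth_pre_rec _ c) // cats0.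
rewrite mem_cat inE; case: c nthE nthE0 => [a|x] nthE nthE0 /=.
  apply/orP; left; apply/mapP; exists a; first by rewrite mem_enum.
  congr cons; apply: (@eq_from_nth _ (inr 0)); rewrite size_pre_rec ?size_pre //.
  move=> t lt_tw; rewrite nthE // nthE0 //.
  case: (nth _ w t) => //= y; congr inr; rewrite mem_cat index_cat inE.
  by rewrite orbF; case: (inr y \in rev _).
(* A leading parameter [x] affects the encoding of [w] only at the first occurrence of [x], if there
   is one. *)
apply/orP; right; case xw: (inr x \in w); last first.
  apply/orP; left; rewrite /pre /= eqseq_cons eqxx /=; apply/eqP.
  apply: (@eq_from_nth _ (inr 0)); rewrite ?size_pre_rec //.
  move=> t lt_tw; rewrite nthE // nthE0 //.
  case wt: (nth _ w t) => [//|y] /=; congr inr; rewrite mem_cat index_cat inE.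
  have [yx|_] := eqVneq (inr y : Sigma + Pi) (inr x).
    by rewrite -yx -wt mem_nth in xw.
  by rewrite orbF; case: (inr y \in rev _).
have lt_iw : index (inr x) w < size w by rewrite index_mem.
apply/orP; right; apply/mapP; exists (index (inr x) w).
  rewrite mem_filter mem_iota add0n size_pre lt_iw andbT.
  by rewrite (@pre_zeroP w _ x) ?nth_index ?eqxx.
congr cons; apply: (@eq_from_nth _ (inr 0)).
  by rewrite size_set_nth size_pre_rec size_pre (maxn_idPr _).
move=> t; rewrite size_pre_rec => lt_tw; rewrite nth_set_nth /= nthE //.
(* Characterizes the position altered by [set_nth] through the symbols read so far, which is what
   [back_ref] inspects. *)
have tE : (t == index (inr x) w) = (inr x \notin take t w) && (nth (inr x) w t == inr x).
  apply/eqP/andP => [->|[xt /eqP wt]].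
    by rewrite nth_index // in_take ?ltnn // ltnW.
  apply/eqP; rewrite -pre_zeroP // nthE0 // wt /= mem_rev.
  by rewrite (negbTE xt).
rewrite tE; case wt: (nth _ w t) => [a|y] /=.
  by rewrite andbF nthE0 // wt.
rewrite mem_cat index_cat inE mem_rev.
have -> : (inr y == inr x :> Sigma + Pi) = (y == x) by [].
have [yx|ne_yx] := eqVneq y x; last first.
  by rewrite andbF orbF nthE0 // wt /= mem_rev; case: (_ \in take _ _).
rewrite yx in wt *; rewrite orbT andbT /= eqxx.
case xt: (inr x \in take t w) => /=; first by rewrite nthE0 // wt /= mem_rev xt.
move: tE; rewrite wt xt eqxx => /eqP <-.
by rewrite size_rev size_take lt_tw addn0.
Qed.

End Encoding.

(** * Counting nodes, and uniqueness of parents *)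

Section Counting.

Variables (Sigma Pi : finType) (T : pstring Sigma Pi).
Implicit Types u v : pvstring Sigma.

Lemma PrevSubP u :
  reflect (exists x w y, T = x ++ w ++ y /\ u = pre w) (u \in PrevSub T).
Proof.
rewrite mem_undup; apply: (iffP allpairsP) => [[[i j] /= [_ _ ->]]|].
  exists (take i.-1 (take j T)), (sub i j T), (drop j T).
  by rewrite /sub catA !cat_take_drop.
case=> x [w [y [TE ->]]]; exists ((size x).+1, size x + size w).
split; rewrite ?mem_iota ?TE ?size_cat /=; [lia | lia |].
by rewrite /sub catA take_size_cat ?size_cat // drop_size_cat.
Qed.

Lemma uniq_PrevSub : uniq (PrevSub T).
Proof. exact: undup_uniq. Qed.

(** Double counting: [v] can only be a child of its prefix of length [(size v).-1]. *)
Lemma sum_children : \sum_(u <- PrevSub T) size (children T u) <= size (PrevSub T).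
Proof.
rewrite -[leqRHS]sum1_size.
under eq_bigr => u _ do rewrite size_filter -sum1_count big_mkcond.
rewrite exchange_big /=; apply: leq_sum => v _; rewrite -big_mkcond sum1_count.
apply: (@leq_trans (count_mem (take (size v).-1 v) (PrevSub T))).
  apply: sub_count => u /= /andP[/eqP ->]; rewrite prefixE => /eqP vu.
  by rewrite -[X in X == _]vu.
by rewrite count_uniq_mem ?uniq_PrevSub // leq_b1.
Qed.

Lemma count_branching :
  count (is_branching T) (PrevSub T) <= count (is_leaf T) (PrevSub T).
Proof.
(* With the number of nodes added to both sides, the inequality holds node by node: 1 + [branching]
   is at most the number of children + [leaf]. *)
rewrite -(leq_add2l (size (PrevSub T))).
apply: leq_trans (leq_add sum_children (leqnn _)).
rewrite -[X in X + _ <= _]sum1_size -!sum1_count.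
rewrite [X in _ + X <= _]big_mkcond [X in _ <= _ + X]big_mkcond -!big_split /=.
apply: leq_sum => u _; rewrite /is_branching /is_leaf.
by case: (size _) => [|[|c]].
Qed.

(** If an occurrence of [w] is followed by a symbol [c], then [pre (rcons w c)] is a child of
    [pre w]; hence a leaf encodes one of the [(size T).+1] suffixes, the empty one included. *)
Lemma count_leaf : count (is_leaf T) (PrevSub T) <= (size T).+1.
Proof.
rewrite -size_filter -[leqRHS](size_iota 0) -(size_map (fun i => pre (drop i T))).
apply: uniq_leq_size => [|u]; first by rewrite filter_uniq ?uniq_PrevSub.
rewrite mem_filter => /andP[leaf_u /PrevSubP[x [w [[|c y] [TE uE]]]]].
  apply/mapP; exists (size x); first by rewrite mem_iota TE size_cat; lia.
  by rewrite TE cats0 drop_size_cat.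
have: pre (rcons w c) \in children T u.
  rewrite mem_filter uE !size_pre size_rcons eqxx -cats1 pre_cat prefix_prefix.
  by apply/PrevSubP; exists x, (w ++ [:: c]), y; rewrite -pre_cat TE -!catA.
by rewrite (size0nil (eqP leaf_u)).
Qed.

Lemma count_type1 : count (type1 T) (PrevSub T) <= 2 * (size T).+1 + 1.
Proof.
apply: (@leq_trans (count (pred1 [::]) (PrevSub T)
    + (count (is_leaf T) (PrevSub T) + count (is_branching T) (PrevSub T)))).
  rewrite -!sum1_count !(big_mkcond _ (fun=> 1)) -!big_split /=.
  apply: leq_sum => u _; rewrite /type1.
  by case: eqP; case: is_leaf; case: is_branching; case: (u \in _).
rewrite count_uniq_mem ?uniq_PrevSub //.
by have := count_leaf; have := count_branching; case: (_ \in _) => /=; lia.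
Qed.

Lemma count_type2 :
  count (type2 T) (PrevSub T)
    <= (#|Sigma| + #|Pi| + 1) * count (type1 T) (PrevSub T).
Proof.
set K := _ + 1; set V1 := [seq v <- PrevSub T | type1 T v].
apply: (@leq_trans (size (flatten [seq sl_preimages v | v <- V1]))).
  rewrite -size_filter; apply: uniq_leq_size => [|u].
    by rewrite filter_uniq ?uniq_PrevSub.
  rewrite mem_filter => /andP[/and3P[uT ntype1_u type1_slu] _].
  have /PrevSubP[x [[|c w] [y [TE uE]]]] := uT.
    (* The root is of Type 1, so a Type 2 node has a first symbol to delete. *)
    by rewrite /type1 uT uE in ntype1_u.
  apply/flatten_mapP; exists (pre w).
    rewrite mem_filter -(sl_pre_cons c w) -uE type1_slu.
    by case/andP: type1_slu.
  by rewrite uE mem_sl_preimages.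
rewrite size_flatten /shape -map_comp sumnE big_map -size_filter -/V1.
rewrite -sum1_size big_distrr /= big_seq [leqRHS]big_seq.
apply: leq_sum => v; rewrite mem_filter muln1 => /andP[_].
by case/PrevSubP=> x [w [y [_ ->]]]; apply: size_sl_preimages.
Qed.

Lemma size_plst_nodes :
  size (plst_nodes T) <= (#|Sigma| + #|Pi| + 2) * (2 * (size T).+1 + 1).
Proof.
rewrite size_filter.
have le_U : count [predU type1 T & type2 T] (PrevSub T)
    <= count (type1 T) (PrevSub T) + count (type2 T) (PrevSub T).
  by rewrite -count_predUI leq_addr.
apply: leq_trans le_U _; apply: leq_trans (leq_add (leqnn _) count_type2) _.
by rewrite -mulSn -addnS leq_mul2l count_type1 orbT.
Qed.

(** If two sources differed in length, the longer one would be a node strictly inside the edge from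
    the shorter one. Prefixes of [v] of equal length coincide. *)
Lemma plst_edge_inj u u' v : plst_edge T u v -> plst_edge T u' v -> u = u'.
Proof.
have no_lt w w' : plst_edge T w v -> plst_edge T w' v -> ~~ (size w < size w').
  case/and5P=> _ _ _ _ /allP no_mid /and5P[w'V _ /prefixP[z vE] lt_w'v _].
  apply/negP => lt_ww'.
  suff /no_mid : size w' \in iota (size w).+1 (size v - (size w).+1).
    by rewrite vE take_size_cat // w'V.
  by rewrite mem_iota; lia.
move=> uv u'v; have [szE] : size u = size u'.
  by have := no_lt _ _ uv u'v; have := no_lt _ _ u'v uv; lia.
case/and5P: uv => _ _ /prefixP[z vE] _ _.
case/and5P: u'v => _ _ /prefixP[z' vE'] _ _.
by rewrite -(take_size_cat z (erefl (size u))) -vE szE vE' take_size_cat.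
Qed.

End Counting.

(** * Construction of the stored text and the size bound *)

Section Storage.

(** Choice over a finite list, provable without axioms; it turns the existence of a factor for each
    edge into a position function. *)
Lemma choose_on (I : eqType) (C : Type) (P : I -> C -> Prop) (c0 : C) (s : seq I) :
  (forall e, e \in s -> exists c, P e c) ->
  exists f : I -> C, forall e, e \in s -> P e (f e).
Proof.
elim: s => [|e s IH] exP; first by exists (fun=> c0).
have [e' e's|f fP] := IH; first by apply: exP; rewrite inE e's orbT.
have [c Pc] := exP e (mem_head e s).
exists (fun e' => if e' == e then c else f e') => e'; rewrite inE.
by case: eqP => [->|_ /fP].
Qed.

Lemma subE (A : Type) i j (w : seq A) : sub i j w = take (j - i.-1) (drop i.-1 w).
Proof.
rewrite /sub take_drop; case: (leqP i.-1 j) => [/subnK -> //|lt_ji].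
by rewrite !drop_oversize // ?size_take; case: ifP; lia.
Qed.

(** The deleted symbol [c] has 1-indexed position [(size a).+1]; an interval avoiding it moves left
    by one exactly when it lies to the right, which [d] records. *)
Lemma sub_delete (A : Type) (a : seq A) c b i j : 1 <= i <= j ->
  ~~ (i <= (size a).+1 <= j) ->
  let d := (size a).+1 < i in
  sub (i - d) (j - d) (a ++ b) = sub i j (a ++ c :: b).
Proof.
move=> ij /=; case: (ltnP (size a).+1 i) => /= [lt_ai _|le_ia lt_ja]; last first.
  by rewrite !subn0 /sub !takel_cat //; lia.
rewrite !subE -cat_rcons !drop_cat size_rcons.
have -> : (i - 1).-1 < size a = false by lia.
have -> : i.-1 < (size a).+1 = false by lia.
by congr take; [lia | congr drop; lia].
Qed.

(** Induction on the length of [w]: as long as some position lies in no interval, delete it and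
    shift the intervals to its right. *)
Lemma delete_unreferenced (A I : eqType) (E : seq I) (w : seq A) (lo hi : I -> nat) :
  (forall e, e \in E -> 1 <= lo e <= hi e /\ hi e <= size w) ->
  exists w' lo' hi', [/\ subseq w' w,
    forall e, e \in E -> [/\ 1 <= lo' e <= hi' e, hi' e <= size w'
                         & sub (lo' e) (hi' e) w' = sub (lo e) (hi e) w]
    & forall p, 1 <= p <= size w' -> exists2 e, e \in E & lo' e <= p <= hi' e].
Proof.
have [n] := ubnP (size w); elim: n => // n IH in w lo hi * => le_wn inE.
case: (boolP (all (fun p => has (fun e => lo e <= p <= hi e) E) (iota 1 (size w)))).
  move=> /allP covered; exists w, lo, hi; split=> // [e /inE[]|p p_in] //.
  by apply/hasP/covered; rewrite mem_iota; lia.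
case/allPn=> p; rewrite mem_iota => p_in /hasPn uncovered.
have [a [c [b [wE sz_a]]]] : exists a c b, w = a ++ c :: b /\ (size a).+1 = p.
  case wE: w p_in => [|c0 w0]; first by rewrite /=; lia.
  rewrite -wE => p_in; exists (take p.-1 w), (nth c0 w p.-1), (drop p w).
  have -> : drop p w = drop p.-1.+1 w by congr drop; lia.
  rewrite -drop_nth ?cat_take_drop ?size_take //; last by lia.
  by split=> //; case: ifP; lia.
pose d e : nat := p < lo e.
have szE : size w = (size (a ++ b)).+1 by rewrite wE !size_cat /=; lia.
have [|e eE|w' [lo' [hi' [w'ab lohi' covered]]]] :=
  IH (a ++ b) (fun e => lo e - d e) (fun e => hi e - d e); first by lia.
  by have := uncovered e eE; have := inE e eE; rewrite /d; case: ltnP => /=; lia.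
exists w', lo', hi'; split=> // [|e eE].
  apply: subseq_trans w'ab _; rewrite wE.
  by rewrite cat_subseq // subseq_cons.
have [-> -> ->] := lohi' e eE; split=> //.
have [] := inE e eE; rewrite wE /d -sz_a => lohi _.
by apply: sub_delete => //; rewrite sz_a uncovered.
Qed.

Variables (Sigma Pi : finType) (T : pstring Sigma Pi).
Implicit Types u v : pvstring Sigma.

(** Write [v = pre w] with [T = x ++ w ++ y]. The part of [pre T] over this occurrence is
    [pre_rec (rev x) w], whose 1-re-encoding is [v]; dropping the first [size u] symbols turns 1
    into [1 - size u]. *)
Lemma str_factor u v : plst_edge T u v ->
  exists ij : nat * nat, [&& 1 <= ij.1 <= ij.2, ij.2 <= size (pre T)
    & str u v == reenc (1 - (size u)%:Z)%R (sub ij.1 ij.2 (pre T))].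
Proof.
case/and5P=> _ vV _ lt_uv _.
have : v \in PrevSub T by move: vV; rewrite mem_filter => /andP[].
case/PrevSubP=> x [w [y [TE vE]]].
have szT : size (pre T) = size x + size w + size y.
  by rewrite size_pre TE !size_cat addnA.
exists (size x + size u + 1, size x + size w).
move: lt_uv; rewrite vE size_pre => lt_uw.
apply/and3P; split; rewrite /= ?szT; [by lia | by lia |].
rewrite /str -(reenc_pre_rec (rev x) w) drop_reenc /sub.
rewrite TE catA pre_cat take_size_cat ?size_pre ?size_cat //.
rewrite pre_cat drop_cat size_pre ifN; last by lia.
by apply/eqP; congr (reenc _ (drop _ _)); lia.
Qed.

Lemma plst_store_exists : exists S : plst_store Sigma, stores_plst T S.
Proof.
pose V := plst_nodes T.
pose E := [seq e <- [seq (u, v) | u <- V, v <- V] | plst_edge T e.1 e.2].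
have memE u v : ((u, v) \in E) = plst_edge T u v.
  rewrite mem_filter /= andb_idr // => uv; apply/allpairsP; exists (u, v).
  by case/and5P: uv.
have uniqV : uniq V by rewrite filter_uniq ?uniq_PrevSub.
(* Only edges labelled by triples may keep positions of the text alive. *)
pose F := [seq e <- E | ~~ short_label T e.1 e.2].
have [|pos posP] := choose_on (s := F) (P := fun e ij =>
  [&& 1 <= ij.1 <= ij.2, ij.2 <= size (pre T)
    & str e.1 e.2 == reenc (1 - (size e.1)%:Z)%R (sub ij.1 ij.2 (pre T))]) (0, 0).
  by move=> [u v]; rewrite mem_filter memE => /andP[_ /str_factor].
have [|T' [lo [hi [subT' lohi covered]]]] :=
  @delete_unreferenced _ _ F (pre T) (fun e => (pos e).1) (fun e => (pos e).2).
  by move=> e /posP/and3P[].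
(* Cutting [[lo:hi]] out of a re-encoding of the whole text lowers its parameter by [lo.-1]; adding
   [lo.-1] to [1 - size u] compensates. *)
pose lab u v : edge_label Sigma :=
  if short_label T u v then LSym (head (inr 0) (str u v))
  else LTriple _ (lo (u, v)) (hi (u, v))
         (1 - (size u)%:Z + (lo (u, v)).-1%:Z)%R.
exists (PlstStore [seq node_data T V u | u <- V] [seq edge_data V lab e | e <- E] T').
exists V, E, lab; split=> //.
- split=> //; rewrite filter_uniq // allpairs_uniq //.
  by move=> [? ?] [? ?].
- move=> u v uvE; rewrite /lab /=; case: ifP => [sh|nshort] /=; rewrite ?sh.
    (* Edges have nonempty labels, so the default of [head] is never returned. *)
    have: size (str u v) != 0.
      by move: uvE; rewrite memE size_drop subn_eq0 -ltnNge => /and5P[].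
    by case: (str u v) => //= a s _; rewrite eqxx.
  have uvF : (u, v) \in F by rewrite mem_filter nshort.
  have [-> -> subE'] := lohi _ uvF; rewrite nshort /=.
  have /and3P[_ _ /eqP ->] := posP _ uvF.
  by rewrite -subE' sub_reenc GRing.addrK eqxx.
split=> // p /covered[[u v] uvF lohi_p].
exists u, v, (lo (u, v)), (hi (u, v)), (1 - (size u)%:Z + (lo (u, v)).-1%:Z)%R.
move: uvF; rewrite mem_filter => /andP[/negbTE nshort uvE].
by split; rewrite // /lab nshort.
Qed.

Lemma leq_sum_size (A : Type) (f : A -> nat) k s :
  (forall a, f a <= k) -> \sum_(a <- s) f a <= k * size s.
Proof.
move=> le_fk; rewrite -sum1_size big_distrr /=; apply: leq_sum => a _.
by rewrite muln1.
Qed.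

(** A node takes 3 words and an edge at most 6. Since edges have distinct targets, there are at most
    as many edges as nodes, which gives 9 words per node. *)
Lemma plst_size_bound (S : plst_store Sigma) : stores_plst T S ->
  plst_size S <= 9 * size (plst_nodes T) + size T.
Proof.
case=> V [E [lab [[uniqV VE] [uniqE EE] [nodesE edgesE] _ [subT' _]]]].
have szV : size V = size (plst_nodes T).
  by apply/perm_size/uniq_perm; rewrite ?filter_uniq ?uniq_PrevSub.
have szE : size E <= size V.
  rewrite -(size_map snd); apply: uniq_leq_size.
    rewrite map_inj_in_uniq // => -[u v] [u' v'] /=; rewrite !EE.
    by move=> uv u'v' vv'; rewrite -vv' in u'v' *; rewrite (plst_edge_inj uv u'v').
  by move=> v /mapP[[u w] + ->]; rewrite EE VE => /and5P[].
have nodes_le : \sum_(r <- st_nodes S) node_record_size r <= 3 * size V.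
  by rewrite -(size_map (node_data T V)) -nodesE leq_sum_size.
have edges_le : \sum_(r <- st_edges S) edge_record_size r <= 6 * size E.
  rewrite -(size_map (edge_data V lab)) -edgesE leq_sum_size //.
  by case=> ? ? ? [].
rewrite -szV; apply: leq_add; last by rewrite -(size_pre T) size_subseq.
apply: leq_trans (leq_add nodes_le edges_le) _.
by rewrite (mulnDl 3 6) leq_add2l leq_mul2l szE orbT.
Qed.

End Storage.

Theorem theorem2 (Sigma Pi : finType) :
  exists C : nat, forall (n : nat) (T : pstring Sigma Pi) (d : Sigma),
    size T = n -> sentinel_terminated d T ->
    (exists S : plst_store Sigma, stores_plst T S)
    /\ (forall S : plst_store Sigma, stores_plst T S -> plst_size S <= C * n).
Proof.
(* The sentinel gives [n >= 1], so [2 * n.+1 + 1 <= 5 * n], and 45 is 9 times 5. The final 1 pays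
   for the stored text. *)
exists (45 * (#|Sigma| + #|Pi| + 2) + 1) => n T d sz_T [T0 TE _].
split=> [|S /plst_size_bound]; first exact: plst_store_exists.
have n_gt0 : 0 < n by rewrite -sz_T TE size_rcons.
move/leq_trans; apply; have := size_plst_nodes T; rewrite sz_T.
by set K := _ + 2; nia.
Qed.
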